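(* Let $q$ be a prime power and let $\mathscr{S}_T$ be the tangent splash, with centre $T$, of an order-$q$-subplane of $\mathrm{PG}(2,q^3)$ meeting $\ell_\infty$ exactly in $T$. Consider the incidence structure whose points are the $q^2$ points of $\mathscr{S}_T\setminus\{T\}$, whose lines are the order-$q$-sublines of $\ell_\infty$ that contain $T$ and are contained in $\mathscr{S}_T$ (each regarded as its set of points other than $T$), with incidence given by inclusion. This incidence structure is an affine plane of order $q$.
   Context: An order-$q$-subplane of $\mathrm{PG}(2,q^3)$ is a subplane of order $q$, equivalently an image of $\mathrm{PG}(2,q)$ under $\mathrm{PGL}(3,q^3)$. An order-$q$-subline of a line of $\mathrm{PG}(2,q^3)$ is an image of $\mathrm{PG}(1,q)$ under $\mathrm{PGL}(2,q^3)$. $\ell_\infty$ is a fixed line of $\mathrm{PG}(2,q^3)$. If $\pi$ is an order-$q$-subplane meeting $\ell_\infty$ in exactly one point $T$, its tangent splash $\mathscr{S}_T$ is the set of points of $\ell_\infty$ lying on the extension to $\mathrm{PG}(2,q^3)$ of some line of $\pi$ ($q^2+1$ points); $T$ is its centre. *)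

(* Defs.v *)
From HB Require Import structures.
From mathcomp Require Import all_boot all_order all_algebra all_field.
Set Implicit Arguments.
Unset Strict Implicit.
Unset Printing Implicit Defensive.
Import GRing.Theory.
Local Open Scope ring_scope.

Section FiniteInstances.
Import VectorInternalTheory.
Variables (F : finFieldType) (U V : vectType F).

HB.instance Definition _ := [Countable of {vspace V} by <:].
HB.instance Definition _ := [Finite of {vspace V} by <:].
HB.instance Definition _ := [Countable of 'Hom(U, V) by <:].
HB.instance Definition _ := [Finite of 'Hom(U, V) by <:].

End FiniteInstances.

Section Geometry.
Variable F : finFieldType.

(* PG(n-1, F) is the lattice of subspaces of F^n; a projective subspace is
   represented by the vector subspace itself, so dim 1 = point, dim 2 = line,
   and incidence is inclusion of subspaces. *)
Definition is_point n (P : {vspace 'rV[F]_n}) : bool := \dim P == 1%N.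
Definition is_line n (l : {vspace 'rV[F]_n}) : bool := \dim l == 2.

Definition points_on n (l : {vspace 'rV[F]_n}) : {set {vspace 'rV[F]_n}} :=
  [set P | is_point P && (P <= l)%VS].

(* If F has q^h elements, this is its unique subfield of order q. *)
Definition Fq (q : nat) : {pred F} := [pred x : F | x ^+ q == x].

(* The canonical copy of PG(n-1, q) inside PG(n-1, F). *)
Definition canonical_PG (q n : nat) : {set {vspace 'rV[F]_n}} :=
  [set <[v]>%VS | v : 'rV[F]_n & (v != 0) && (v \is a mxOver (Fq q))].

Definition subplane (q : nat) (B : {set {vspace 'rV[F]_3}}) : bool :=
  [exists f : 'Hom('rV[F]_3, 'rV[F]_3),
     (lker f == 0%VS) && (B == [set (f @: P)%VS | P in canonical_PG q 3])].

(* Ranging over all linear isomorphisms F^2 -> l accounts both for the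
   identification of l with PG(1, F) and for the element of PGL(2, F). *)
Definition subline (q : nat) (l : {vspace 'rV[F]_3})
    (s : {set {vspace 'rV[F]_3}}) : bool :=
  [exists f : 'Hom('rV[F]_2, 'rV[F]_3),
     [&& lker f == 0%VS, limg f == l
       & s == [set (f @: P)%VS | P in canonical_PG q 2]]].

(* The lines of the plane over F which extend lines of the subplane B, i.e.
   which join two distinct points of B. *)
Definition extended_lines (B : {set {vspace 'rV[F]_3}}) :
    {set {vspace 'rV[F]_3}} :=
  [set l | is_line l && (1 < #|B :&: points_on l|)%N].

(* The points of linf covered by the extended lines of B; it is the tangent
   splash with centre T when B :&: points_on linf = [set T]. *)
Definition splash (B : {set {vspace 'rV[F]_3}}) (linf : {vspace 'rV[F]_3}) :
    {set {vspace 'rV[F]_3}} :=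
  [set P in points_on linf | [exists l in extended_lines B, (P <= l)%VS]].

Definition splash_lines (q : nat) (linf T : {vspace 'rV[F]_3})
    (S : {set {vspace 'rV[F]_3}}) : {set {set {vspace 'rV[F]_3}}} :=
  [set s :\ T | s : {set {vspace 'rV[F]_3}}
              & [&& subline q linf s, T \in s & s \subset S]].

End Geometry.

(* Points are the elements of X, lines are the members of L, incidence is
   membership. *)
Definition affine_plane (T : finType) (X : {set T}) (L : {set {set T}}) : Prop :=
  [/\ (forall l, l \in L -> l \subset X),
      (forall P Q, P \in X -> Q \in X -> P != Q ->
         exists! l, [/\ l \in L, P \in l & Q \in l]),
      (forall P l, P \in X -> l \in L -> P \notin l ->
         exists! m, [/\ m \in L, P \in m & [disjoint m & l]]) &
      (exists P Q R, [/\ P \in X, Q \in X, R \in X, P != Q &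
         forall l, l \in L -> ~~ [&& P \in l, Q \in l & R \in l]])].

Definition affine_plane_of_order (q : nat) (T : finType) (X : {set T})
    (L : {set {set T}}) : Prop :=
  affine_plane X L /\ forall l, l \in L -> #|l| = q.

(* Main.v *)
From HB Require Import structures.
Require Import Defs.
From mathcomp Require Import all_boot all_order all_algebra all_field.
From mathcomp Require Import ring.
Set Implicit Arguments.
Unset Strict Implicit.
Unset Printing Implicit Defensive.
Import GRing.Theory.
Local Open Scope ring_scope.

(* Let K be the subfield of order q. In coordinates where the subplane is
   PG(2, K), choose a K-basis v0, v1, v2 of K^3 such that v0 spans T. The line
   linf meets the span of v1 and v2 in a point t = w v1 + v2, and w is not in K
   because T is the only K-rational point of linf. A K-rational line that misses
   T meets linf in a point t + (x + y w) v0 with x, y in K, and every such point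
   arises. Thus S \ {T} is an affine copy of the K-plane K + K w, and an
   order-q-subline through T is the set T together with the t + (a + b k) v0,
   k in K. It lies in S exactly when a and b lie in K + K w, so these sublines
   are the lines of AG(2, K). *)

(** Every relation in the axioms is preserved and reflected by an injection, and so are
    cardinalities. The geometry on the line can thus be traded for a coordinate in [F]. *)
Lemma affine_plane_of_order_imset (q : nat) (T T' : finType) (phi : T -> T')
    (X : {set T}) (L : {set {set T}}) :
  injective phi -> affine_plane_of_order q X L ->
  affine_plane_of_order q (phi @: X) [set phi @: (l : {set T}) | l in L].
Proof.
move=> phi_inj [[subX joinX parX nondeg] sizeL].
split=> [|_ /imsetP[l Ll ->]]; last by rewrite card_imset // sizeL.
split.
- by move=> _ /imsetP[l Ll ->]; rewrite imsetS // subX.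
- move=> _ _ /imsetP[P XP ->] /imsetP[Q XQ ->]; rewrite inj_eq // => neqPQ.
  have [l [[Ll lP lQ] l_uniq]] := joinX P Q XP XQ neqPQ.
  exists (phi @: l); split; first by rewrite !imset_f.
  move=> _ [/imsetP[m Lm ->]]; rewrite !mem_imset // => mP mQ.
  by rewrite (l_uniq m).
- move=> _ _ /imsetP[P XP ->] /imsetP[l Ll ->]; rewrite mem_imset // => nlP.
  have disjE (m : {set T}) : [disjoint phi @: m & phi @: l] = [disjoint m & l].
    by rewrite -!setI_eq0 -imsetI ?imset_eq0 //; apply: in2W.
  have [m [[Lm mP dml] m_uniq]] := parX P l XP Ll nlP.
  exists (phi @: m); split; first by rewrite disjE !imset_f.
  move=> _ [/imsetP[m' Lm' ->]]; rewrite mem_imset // disjE => m'P dm'l.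
  by rewrite (m_uniq m').
- have [P [Q [R [XP XQ XR neqPQ noline]]]] := nondeg.
  exists (phi P), (phi Q), (phi R); split; rewrite ?imset_f ?inj_eq //.
  by move=> _ /imsetP[l Ll ->]; rewrite !mem_imset // noline.
Qed.

(** * The affine plane AG(2, K) realised on K + K w inside F *)

Section AffineLines.
Variables (F : finFieldType) (K : divringClosed F).

Definition Kline (a b : F) : {set F} := [set a + b * k | k in K].

(** For w outside K this is a two-dimensional K-subspace of F; it will be the set of coordinates of
    the splash without its centre. *)
Definition Kplane (w : F) : {set F} := [set x + y * w | x in K, y in K].

Definition Kplane_lines (w : F) : {set {set F}} :=
  [set Kline a b | a in Kplane w, b in Kplane w :\ 0].

Lemma card_Kline (a b : F) : b != 0 -> #|Kline a b| = #|K|.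
Proof. by move=> b0; rewrite card_imset // => x y /addrI /(mulfI b0). Qed.

(** The affine substitution i -> j + k i permutes K, so the base point can be moved along the line
    and the direction rescaled within K. The uniqueness arguments below rest on this. *)
Lemma Kline_translate (a b c k : F) :
  c \in Kline a b -> k \in K -> k != 0 -> Kline a b = Kline c (b * k).
Proof.
case/imsetP=> j Kj -> Kk k0; apply/setP=> x.
apply/imsetP/imsetP=> -[i Ki ->].
  by exists ((i - j) / k); [rewrite rpred_div ?rpredB | field].
by exists (j + k * i); [rewrite rpredD ?rpredM | ring].
Qed.

Variable w : F.
Hypothesis w_notin_K : w \notin K.

(** Two representations with y != y' would exhibit w as a quotient of elements of K. *)
Lemma Kplane_inj (x y x' y' : F) :
  x \in K -> y \in K -> x' \in K -> y' \in K ->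
  x + y * w = x' + y' * w -> x = x' /\ y = y'.
Proof.
move=> Kx Ky Kx' Ky' E; suff yE : y = y'.
  by move: E; rewrite yE => /addIr.
apply/eqP; apply: contraNT w_notin_K; rewrite -subr_eq0 => neq.
have -> : w = (x' - x) / (y - y').
  apply: (mulIf neq); rewrite divfK // mulrBr.
  rewrite [w * y]mulrC [w * y']mulrC; apply/eqP.
  by rewrite subr_eq addrAC -E [x + _]addrC addrK.
by rewrite rpred_div ?rpredB.
Qed.

Lemma card_Kplane : #|Kplane w| = (#|K| ^ 2)%N.
Proof.
have -> : Kplane w = [set z.1 + z.2 * w | z in [predX K & K]].
  apply/setP=> z; apply/imset2P/imsetP.
    by move=> [x y Kx Ky ->]; exists (x, y); rewrite // inE /= Kx.
  by move=> [[x y] /andP[Kx Ky] ->]; exists x y.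
rewrite card_in_imset ?cardX // => -[x y] [x' y'] /andP[/= Kx Ky] /andP[/= Kx' Ky'].
by move=> E; have [-> ->] := Kplane_inj Kx Ky Kx' Ky' E.
Qed.

Lemma KplaneD (a b : F) : a \in Kplane w -> b \in Kplane w -> a + b \in Kplane w.
Proof.
case/imset2P=> x y Kx Ky -> /imset2P[x' y' Kx' Ky' ->].
by apply/imset2P; exists (x + x') (y + y'); rewrite ?rpredD //; ring.
Qed.

Lemma KplaneM (a k : F) : a \in Kplane w -> k \in K -> a * k \in Kplane w.
Proof.
case/imset2P=> x y Kx Ky -> Kk.
by apply/imset2P; exists (x * k) (y * k); rewrite ?rpredM //; ring.
Qed.

Lemma KplaneB (a b : F) : a \in Kplane w -> b \in Kplane w -> a - b \in Kplane w.
Proof. by move=> Wa Wb; rewrite KplaneD // -mulrN1 KplaneM // rpredN rpred1. Qed.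

(** The determinant over K of the coordinates of b and c decides: if it vanishes, c is a K-multiple
    of b; otherwise Cramer's rule gives i and j. *)
Lemma Kplane_span (b c d : F) :
  b \in Kplane w -> c \in Kplane w -> d \in Kplane w -> b != 0 ->
  (exists2 k, k \in K & c = b * k) \/
  (exists i j, [/\ i \in K, j \in K & d = b * i + c * j]).
Proof.
case/imset2P=> b1 b2 Kb1 Kb2 -> /imset2P[c1 c2 Kc1 Kc2 ->].
case/imset2P=> d1 d2 Kd1 Kd2 -> b0.
have [D0 | D0] := eqVneq (b1 * c2 - b2 * c1) 0; last first.
  right; exists ((d1 * c2 - d2 * c1) / (b1 * c2 - b2 * c1)).
  exists ((b1 * d2 - b2 * d1) / (b1 * c2 - b2 * c1)).
  by split; rewrite ?rpred_div ?rpredB ?rpredM //; field.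
left; have {}D0 : b1 * c2 = b2 * c1 by apply/eqP; rewrite -subr_eq0 D0.
have [b10 | b10] := eqVneq b1 0; last first.
  exists (c1 / b1); first by rewrite rpred_div.
  rewrite [c2](_ : _ = b2 * c1 / b1); first by field.
  by rewrite -D0 mulrAC divff // mul1r.
have b20 : b2 != 0 by apply: contraNneq b0 => ->; rewrite b10 mul0r addr0.
exists (c2 / b2); first by rewrite rpred_div.
have -> : c1 = 0.
  by apply/eqP; move/eqP: D0; rewrite b10 mul0r eq_sym mulf_eq0 (negPf b20).
by rewrite b10; field.
Qed.

(** Read x and y as K-rational coordinate vectors: the equations say that a x + b y has last two
    coordinates r w and r, as a point of [linf] does. Solving them for a and b turns the quotient
    into an explicit element of K + K w with denominator D. *)
Lemma Kplane_cramer (a b r x0 x1 x2 y0 y1 y2 : F) : r != 0 ->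
  [/\ x0 \in K, x1 \in K & x2 \in K] -> [/\ y0 \in K, y1 \in K & y2 \in K] ->
  a * x1 + b * y1 = r * w -> a * x2 + b * y2 = r ->
  (a * x0 + b * y0) / r \in Kplane w.
Proof.
move=> r0 [Kx0 Kx1 Kx2] [Ky0 Ky1 Ky2] E1 E2.
set D := x1 * y2 - x2 * y1.
have Da : a * D = r * (w * y2 - y1).
  transitivity (r * w * y2 - r * y1); last by ring.
  by rewrite -E1 -E2 /D; ring.
have Db : b * D = r * (x1 - w * x2).
  transitivity (r * x1 - r * w * x2); last by ring.
  by rewrite -E1 -E2 /D; ring.
have D0 : D != 0.
  (* If D = 0 then w y2 = y1 and w x2 = x1. A nonzero x2 or y2 would put w in K, and x2 = y2 = 0
     would force r = 0. *)
  apply: contraNneq w_notin_K => D0.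
  have /eqP := Da; rewrite D0 mulr0 eq_sym mulf_eq0 (negPf r0) subr_eq0 => /eqP wy.
  have /eqP := Db; rewrite D0 mulr0 eq_sym mulf_eq0 (negPf r0) subr_eq0 => /eqP wx.
  have [y20 | y20] := eqVneq y2 0; last by rewrite -(mulfK y20 w) wy rpred_div.
  have [x20 | x20] := eqVneq x2 0; last by rewrite -(mulfK x20 w) -wx rpred_div.
  by case/eqP: r0; rewrite -E2 x20 y20 !mulr0 addr0.
apply/imset2P; exists ((x1 * y0 - y1 * x0) / D) ((y2 * x0 - x2 * y0) / D).
- by rewrite rpred_div ?rpredB ?rpredM.
- by rewrite rpred_div ?rpredB ?rpredM.
rewrite -[a](mulfK D0) -[b](mulfK D0) Da Db; field.
by rewrite D0.
Qed.

Lemma Kline_sub (a b : F) :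
  a \in Kplane w -> b \in Kplane w -> Kline a b \subset Kplane w.
Proof.
by move=> Wa Wb; apply/subsetP=> _ /imsetP[k Kk ->]; rewrite KplaneD ?KplaneM.
Qed.

Lemma Kline_start (a b : F) : a \in Kline a b.
Proof. by apply/imsetP; exists 0; rewrite ?rpred0 // mulr0 addr0. Qed.

Lemma Kplane_line_through (l : {set F}) (a : F) :
  l \in Kplane_lines w -> a \in l ->
  exists2 b, b \in Kplane w :\ 0 & l = Kline a b.
Proof.
case/imset2P=> a' b Wa' Wb -> la; exists b => //.
by rewrite (Kline_translate la (rpred1 K) (oner_neq0 F)) mulr1.
Qed.

Lemma Kplane_linesP (a b : F) :
  a \in Kplane w -> b \in Kplane w -> b != 0 -> Kline a b \in Kplane_lines w.
Proof. by move=> Wa Wb b0; apply: imset2_f => //; rewrite !inE b0. Qed.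

Lemma Kplane_affine_plane :
  affine_plane_of_order #|K| (Kplane w) (Kplane_lines w).
Proof.
split; last first.
  by move=> _ /imset2P[a b _ /setD1P[b0 _] ->]; exact: card_Kline.
split.
- by move=> _ /imset2P[a b Wa /setD1P[_ Wb] ->]; exact: Kline_sub.
- move=> P Q WP WQ neqPQ; exists (Kline P (Q - P)); split.
    split; [|exact: Kline_start|].
      by rewrite Kplane_linesP ?KplaneB // subr_eq0 eq_sym.
    by apply/imsetP; exists 1; rewrite ?rpred1 //; ring.
  move=> m [Lm mP mQ].
  have [b /setD1P[b0 Wb] defm] := Kplane_line_through Lm mP.
  move: mQ; rewrite defm => /imsetP[k Kk defQ].
  have E : Q - P = b * k by rewrite defQ; ring.
  rewrite E -(Kline_translate (Kline_start P b)) //.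
  by apply: contraNneq neqPQ => k0; rewrite defQ k0 mulr0 addr0.
- move=> P _ WP /imset2P[a b Wa /setD1P[b0 Wb] ->] nlP.
  exists (Kline P b); split.
    split; [exact: Kplane_linesP|exact: Kline_start|].
    (* A common point P + b k = a + b j would give P = a + b (j - k), a point of the line. *)
    rewrite -setI_eq0; apply: contraNT nlP => /set0Pn[x /setIP[]].
    case/imsetP=> k Kk -> /imsetP[j Kj E].
    apply/imsetP; exists (j - k); first by rewrite rpredB.
    by rewrite mulrBr addrA -E addrK.
  move=> m [Lm mP dml].
  have [c /setD1P[c0 Wc] defm] := Kplane_line_through Lm mP.
  (* Either the directions agree up to a factor in K, or b and c span the plane; then P - a = b i +
     c j makes P - c j = a + b i a common point of the two lines. *)
  have [[k Kk ck] | [i [j [Ki Kj E]]]] := Kplane_span Wb Wc (KplaneB WP Wa) b0.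
    rewrite defm ck -(Kline_translate (Kline_start P b)) //.
    by apply: contraNneq c0 => k0; rewrite ck k0 mulr0.
  have: P - c * j \in m.
    by rewrite defm; apply/imsetP; exists (- j); rewrite ?rpredN //; ring.
  move/(disjointFr dml)/negP=> []; apply/imsetP; exists i => //.
  by rewrite -[P](subrK a) E; ring.
- have KW x y : x \in K -> y \in K -> x + y * w \in Kplane w.
    by move=> Kx Ky; apply/imset2P; exists x y.
  (* A line through 0 with direction b containing both 1 = b k and w = b j would give w = j / k in
     K. *)
  exists 0, 1, w; split.
  + by have:= KW 0 0 (rpred0 K) (rpred0 K); rewrite mul0r addr0.
  + by have:= KW 1 0 (rpred1 K) (rpred0 K); rewrite mul0r addr0.
  + by have:= KW 0 1 (rpred0 K) (rpred1 K); rewrite mul1r add0r.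
  + by rewrite eq_sym oner_neq0.
  move=> l Ll; apply/and3P=> -[l0 l1 lw].
  have [b /setD1P[b0 _] defl] := Kplane_line_through Ll l0.
  move: l1 lw; rewrite defl => /imsetP[k Kk]; rewrite add0r => E.
  case/imsetP=> j Kj; rewrite add0r => Ew; case/negP: w_notin_K.
  have k0 : k != 0 by apply: contraTneq (oner_neq0 F) => k0; rewrite E k0 mulr0 eqxx.
  by rewrite Ew -[b](mulfK k0) -E mul1r rpredM ?rpredV.
Qed.

End AffineLines.

(** * The subfield of order q *)

Section SubfieldFq.
Variables (F : finFieldType) (q p h : nat).
Hypotheses (p_prime : prime p) (h_gt0 : (0 < h)%N) (defq : q = (p ^ h)%N).
Hypothesis cardF : #|F| = (q ^ 3)%N.

(** Since q is a power of the characteristic p, x -> x^q is a field endomorphism, and its fixed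
    points form a subfield. *)
Lemma Fq_divring_closed : divring_closed (Fq (F := F) q).
Proof.
have pF : p \in [pchar F].
  by apply: (card_finPcharP (n := (h * 3)%N)); rewrite // cardF defq expnM.
have q_nat : [pchar F].-nat q.
  by rewrite defq (eq_pnat _ (pcharf_eq pF)) pnatX pnat_id.
split=> [|x y|x y]; rewrite !inE ?expr1n // => /eqP Kx /eqP Ky.
  by rewrite exprDn_pchar // exprNn_pchar // Kx Ky.
by rewrite exprMn exprVn Kx Ky.
Qed.

(** The polynomial X^q - X divides X^(q^3) - X, the product of all X - x with x in F; hence it
    splits into distinct linear factors and has q roots in F. *)
Lemma card_Fq : #|Fq (F := F) q| = q.
Proof.
have q_gt1 : (1 < q)%N by rewrite defq -(exp1n h) ltn_exp2r // prime_gt1.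
have sizeP : size ('X^q - 'X : {poly F}) = q.+1.
  by rewrite size_polyDl size_polyXn // size_polyN size_polyX.
have dvdP : ('X^q - 'X : {poly F}) %| \prod_(x in F) ('X - x%:P).
  rewrite -finField_genPoly cardF.
  (* The powers of X will telescope: with n = q^k each difference is (X^q)^n - X^n, a multiple of
     X^q - X. *)
  have dvdS k : ('X^q - 'X : {poly F}) %| 'X^(q ^ k.+1) - 'X^(q ^ k).
    by rewrite expnS !exprM subrXX dvdp_mulr.
  have -> : 'X^(q ^ 3) - 'X = ('X^(q ^ 3) - 'X^(q ^ 2)) +
      (('X^(q ^ 2) - 'X^(q ^ 1)) + ('X^(q ^ 1) - 'X^(q ^ 0))) :> {poly F} by ring.
  rewrite dvdp_add ?dvdS // dvdp_add ?dvdS //.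
have [m eqPm] : {m | 'X^q - 'X %= \prod_(x <- mask m (enum F)) ('X - x%:P)}.
  by apply: dvdp_prod_XsubC; rewrite big_enum.
apply/eqP; rewrite -eqSS -sizeP (eqp_size eqPm) size_prod_XsubC eqSS.
rewrite -(card_uniqP (mask_uniq (enum_uniq F) m)); apply/eqP/eq_card => x.
rewrite -[RHS]root_prod_XsubC -(eqp_root eqPm) rootE !hornerE inE.
by rewrite subr_eq0.
Qed.

End SubfieldFq.

(** * Spans of one and of two vectors *)

Section Lines.
Variables (F : fieldType) (V : vectType F).

Lemma vline_inj (u v : V) : v != 0 -> <[u]>%VS = <[v]>%VS ->
  exists2 c, c != 0 & v = c *: u.
Proof.
move=> v0 E; have: v \in <[u]>%VS by rewrite E memv_line.
case/vlineP=> c def_v; exists c => //.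
by apply: contraNneq v0 => c0; rewrite def_v c0 scale0r.
Qed.

Lemma vline_scale (c : F) (v : V) : c != 0 -> <[c *: v]>%VS = <[v]>%VS.
Proof.
move=> c0; apply/eqP; rewrite eqEsubv -!memvE memvZ ?memv_line //=.
by rewrite -{1}[v](scalerK c0) memvZ // memv_line.
Qed.

Lemma dim_addv_lineP (u v : V) :
  reflect (forall a b, a *: u + b *: v = 0 -> a = 0 /\ b = 0)
          (\dim (<[u]> + <[v]>) == 2).
Proof.
have -> : (<[u]> + <[v]>)%VS = <<[:: u; v]>>%VS by rewrite span_cons span_seq1.
apply: (iffP (@freeP _ _ _ (in_tuple [:: u; v]))) => [uv_free a b E | uv_free c].
  have := uv_free (fun i => [:: a; b]`_i).
  rewrite !big_ord_recl big_ord0 /= addr0 => /(_ E) c0.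
  by split; [have := c0 ord0 | have := c0 (lift ord0 ord0)].
rewrite !big_ord_recl big_ord0 /= addr0 => /uv_free[c0 c1] i.
by case: (unliftP ord0 i) => [j|] -> //; rewrite [j]ord1.
Qed.

Lemma memv_addv_lineP (u v w : V) :
  reflect (exists a b, w = a *: u + b *: v) (w \in (<[u]> + <[v]>)%VS).
Proof.
apply: (iffP memv_addP) => [[_ /vlineP[a ->] [_ /vlineP[b ->] ->]] | [a [b ->]]].
  by exists a, b.
by exists (a *: u); [|exists (b *: v)]; rewrite ?memvZ ?memv_line.
Qed.

Lemma addv_line_eq (u v : V) (U : {vspace V}) :
  u \in U -> v \in U -> \dim U = 2 -> \dim (<[u]> + <[v]>) = 2 ->
  (<[u]> + <[v]>)%VS = U.
Proof.
move=> Uu Uv dimU dimuv; apply/eqP.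
by rewrite eqEdim subv_add -!memvE Uu Uv dimU dimuv.
Qed.

Lemma dim_addv_line_neq (u v : V) : u != 0 -> v != 0 -> <[u]>%VS != <[v]>%VS ->
  \dim (<[u]> + <[v]>) = 2.
Proof.
move=> u0 v0 neq_uv; apply/eqP/dim_addv_lineP => a b E.
have [a0 | a0] := eqVneq a 0.
  split=> //; apply/eqP; move/eqP: E.
  by rewrite a0 scale0r add0r scaler_eq0 (negPf v0) orbF.
case/eqP: neq_uv; have -> : u = (- b / a) *: v.
  rewrite mulrC -scalerA scaleNr; apply: canRL (scalerK a0) _.
  by apply/eqP; rewrite -addr_eq0 E.
apply: vline_scale; rewrite mulf_neq0 ?invr_neq0 // oppr_eq0.
apply: contraNneq u0 => b0; move/eqP: E.
by rewrite b0 scale0r addr0 scaler_eq0 (negPf a0).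
Qed.

End Lines.

(** * Bases adapted to a K-rational vector *)

Section Coordinates.
Variables (F : fieldType) (K : divringClosed F).

(** Choose i with v_i != 0 and complete v by the unit vectors other than the i-th. The coordinates
    of w are then w_i / v_i and w_j - (w_i / v_i) v_j, which lie in K when v and w are K-rational.
    This serves for sublines with one extra vector and for subplanes with two. *)
Lemma mxOver_extend_basis n (v : 'rV[F]_n.+1) : v != 0 -> v \is a mxOver K ->
  exists e : 'I_n -> 'rV[F]_n.+1,
  [/\ forall j, e j \is a mxOver K,
      forall w, exists a c, w = a *: v + \sum_j c j *: e j,
      forall a c, a *: v + \sum_j c j *: e j \is a mxOver K ->
        a \in K /\ forall j, c j \in K &
      forall a c, a *: v + \sum_j c j *: e j = 0 -> a = 0 /\ forall j, c j = 0].
Proof.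
move=> v0 /mxOverP Kv.
have [i vi0] : exists i, v 0 i != 0.
  by have /rV0Pn[i vi] := v0; exists i.
pose e j : 'rV[F]_n.+1 := delta_mx 0 (lift i j).
have combi a c : (a *: v + \sum_j c j *: e j) 0 i = a * v 0 i.
  rewrite !mxE summxE big1 ?addr0 // => j _.
  by rewrite !mxE eq_liftF andbF mulr0.
have combl a c j : (a *: v + \sum_j c j *: e j) 0 (lift i j) = a * v 0 (lift i j) + c j.
  rewrite !mxE summxE (bigD1 j) //= big1 => [|k neq_kj].
    by rewrite !mxE !eqxx mulr1 addr0.
  by rewrite !mxE (inj_eq (@lift_inj _ i)) eq_sym (negPf neq_kj) andbF mulr0.
exists e; split.
- by move=> j; apply/mxOverP=> k l; rewrite mxE rpred_nat.
- move=> w; exists (w 0 i / v 0 i).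
  exists (fun j => w 0 (lift i j) - w 0 i / v 0 i * v 0 (lift i j)).
  apply/rowP=> k; case: (unliftP i k) => [j|] ->; last by rewrite combi divfK.
  by rewrite combl addrC subrK.
- move=> a c /mxOverP Kw; have Ka : a \in K.
    by have := Kw 0 i; rewrite combi => K1; rewrite -(mulfK vi0 a) rpred_div.
  split=> // j; have := Kw 0 (lift i j); rewrite combl => K1.
  by rewrite -(addKr (a * v 0 (lift i j)) (c j)) rpredD // rpredN rpredM.
- move=> a c /rowP w0; have a0 : a = 0.
    by apply/eqP; have /eqP := w0 i; rewrite combi mxE mulf_eq0 (negPf vi0) orbF.
  by split=> // j; have := w0 (lift i j); rewrite combl a0 mul0r add0r mxE.
Qed.

End Coordinates.

(** * Projective geometry over F with K-rational points *)

Section Geometry.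
Variables (F : finFieldType) (K : divringClosed F) (q : nat).
Hypothesis FqK : Fq (F := F) q =i K.

Lemma canonical_PGP n (P : {vspace 'rV[F]_n}) :
  reflect (exists v, [/\ v != 0, v \is a mxOver K & P = <[v]>%VS])
          (P \in canonical_PG F q n).
Proof.
have mxOverK (v : 'rV[F]_n) : (v \is a mxOver (Fq q)) = (v \is a mxOver K).
  by apply/mxOverP/mxOverP=> Kv i j; [rewrite -FqK | rewrite FqK].
apply: (iffP imsetP) => [[v] | [v [v0 Kv ->]]].
  by rewrite inE mxOverK => /andP[v0 Kv] ->; exists v.
by exists v; rewrite // inE mxOverK v0.
Qed.

Lemma is_pointP n (P : {vspace 'rV[F]_n}) :
  reflect (exists2 v, v != 0 & P = <[v]>%VS) (is_point P).
Proof.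
apply: (iffP eqP) => [dimP | [v v0 ->]]; last by rewrite dim_vline v0.
have P0 : P != 0%VS by rewrite -dimv_eq0 dimP.
exists (vpick P); first by rewrite vpick0.
by apply/eqP; rewrite eq_sym eqEdim -memvE memv_pick dimP dim_vline vpick0 P0.
Qed.

(** * An affine coordinate on a projective line *)

Section LineCoordinates.
Variables u t : 'rV[F]_3.
Hypothesis dim_ut : \dim (<[u]> + <[t]>) = 2.

(** The coordinate z parametrises the line spanned by [u] and [t] without the point spanned by [u],
    which plays the part of infinity. *)
Definition affine_point (z : F) : {vspace 'rV[F]_3} := <[t + z *: u]>%VS.

Lemma ut_free a b : a *: u + b *: t = 0 -> a = 0 /\ b = 0.
Proof. by move: a b; apply/dim_addv_lineP/eqP. Qed.

Lemma ut_inj a b a' b' : a *: u + b *: t = a' *: u + b' *: t -> a = a' /\ b = b'.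
Proof.
move=> E; have [] := @ut_free (a - a') (b - b').
  by rewrite !scalerBl addrACA E -opprD subrr.
by move=> /subr0_eq -> /subr0_eq ->.
Qed.

Lemma affine_point_neq0 z : t + z *: u != 0.
Proof.
apply/eqP; rewrite addrC -[t]scale1r => /ut_free[_ /eqP].
by rewrite oner_eq0.
Qed.

Lemma affine_point_inj : injective affine_point.
Proof.
move=> z z' /vline_inj[|c c0]; first exact: affine_point_neq0.
rewrite scalerDr scalerA addrC -[t in LHS]scale1r [in RHS]addrC.
by move/ut_inj => [-> <-]; rewrite mul1r.
Qed.

Lemma affine_point_neq_origin z : affine_point z != <[u]>%VS.
Proof.
apply/eqP => E; have := memv_line (t + z *: u).
rewrite -/(affine_point z) E => /vlineP[k].
rewrite addrC -[t]scale1r -[k *: u]addr0 -[X in _ = _ + X](scale0r t).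
by move=> /ut_inj[_ /eqP]; rewrite oner_eq0.
Qed.

Lemma normalize_affine_point a b : b != 0 ->
  <[a *: u + b *: t]>%VS = affine_point (a / b).
Proof.
move=> b0; rewrite /affine_point -[RHS](vline_scale _ b0) scalerDr scalerA.
by rewrite mulrC divfK // addrC.
Qed.

End LineCoordinates.

(** * Order-q-sublines through the point spanned by [u] *)

Section SplashLines.
Variables u t : 'rV[F]_3.
Hypothesis dim_ut : \dim (<[u]> + <[t]>) = 2.
Let phi := affine_point u t.

(** Take a K-basis e, e' of K^2 with g e = lam u and g e' = nu u + mu t. For c != 0 the image of a e
    + c e' has coordinate nu / mu + (lam / mu) (a / c), and a / c runs over K; for c = 0 the image
    is the point spanned by [u]. *)
Lemma subline_through_origin (s : {set {vspace 'rV[F]_3}}) :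
  subline q (<[u]> + <[t]>)%VS s -> <[u]>%VS \in s ->
  exists2 b, b != 0 & exists a, s :\ <[u]>%VS = phi @: Kline K a b.
Proof.
case/existsP=> g /and3P[/lker0P g_inj /eqP limg_g /eqP ->].
case/imsetP=> _ /canonical_PGP[e [e0 Ke ->]]; rewrite limg_line => Eu.
have ge0 : g e != 0 by rewrite -(linear0 g) (inj_eq g_inj).
have [lam lam0 def_ge] := vline_inj ge0 Eu.
have [e_ [Ke_ span_e K_e free_e]] := mxOver_extend_basis e0 Ke.
pose e' := e_ ord0.
have [nu [mu def_ge']] : exists nu mu, g e' = nu *: u + mu *: t.
  by apply/memv_addv_lineP; rewrite -limg_g memv_img ?memvf.
have g_comb a c : g (a *: e + c *: e') = (a * lam + c * nu) *: u + (c * mu) *: t.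
  rewrite linearD !linearZ /= def_ge def_ge' scalerDr !scalerA addrA.
  by rewrite -scalerDl.
(* If mu = 0, then g kills - nu e + lam e', so injectivity of g and independence of e, e' give lam =
   0. *)
have mu0 : mu != 0.
  apply: contraNneq lam0 => mu0; have := free_e (- nu) (fun=> lam).
  rewrite big_ord1; case=> [|_ /(_ ord0) ->] //; apply: g_inj.
  by rewrite g_comb mu0 mulr0 scale0r addr0 mulNr [lam * _]mulrC addNr scale0r linear0.
exists (lam / mu); first by rewrite mulf_neq0 ?invr_neq0.
exists (nu / mu); apply/setP=> P; apply/setD1P/imsetP=> [[neqPu] | [z]].
  case/imsetP=> _ /canonical_PGP[v [v0 Kv ->]]; rewrite limg_line => defP.
  have [a [c_ def_v]] := span_e v; rewrite def_v in Kv.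
  have [Ka Kc_] := K_e _ _ Kv; rewrite big_ord1 -/e' in def_v.
  set c := c_ ord0 in def_v; have Kc : c \in K := Kc_ ord0.
  rewrite def_v g_comb in defP; have [c0 | c0] := eqVneq c 0.
    case/eqP: neqPu; rewrite defP c0 !mul0r scale0r !addr0 vline_scale //.
    rewrite mulf_neq0 //; apply: contraNneq v0 => a0.
    by rewrite def_v a0 c0 !scale0r addr0.
  exists ((a * lam + c * nu) / (c * mu)).
    by apply/imsetP; exists (a / c); [rewrite rpred_div | field; rewrite c0].
  by rewrite defP normalize_affine_point ?mulf_neq0.
case/imsetP=> k Kk -> ->; split; first exact: affine_point_neq_origin.
apply/imsetP; exists <[k *: e + e']>%VS.
  apply/canonical_PGP; exists (k *: e + e'); split=> //; last first.
    by rewrite rpredD ?mxOverZ ?Ke_.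
  apply/eqP=> E0; have := free_e k (fun=> 1); rewrite big_ord1 scale1r.
  by case/(_ E0) => _ /(_ ord0)/eqP; rewrite oner_eq0.
rewrite limg_line -[e']scale1r g_comb !mul1r normalize_affine_point //.
by congr (affine_point u t _); field.
Qed.

Lemma affine_line_subline (a b : F) : b != 0 ->
  subline q (<[u]> + <[t]>)%VS (<[u]>%VS |: phi @: Kline K a b).
Proof.
(* The row (x, y) goes to x b u + y (t + a u): (1, 0) gives the point spanned by [u], and (k, 1) the
   point with coordinate a + b k. *)
move=> b0; pose M := \matrix_(i < 2) [:: b *: u; t + a *: u]`_i.
pose g : 'Hom('rV[F]_2, 'rV[F]_3) := linfun (mulmxr M).
have gE v : g v = (v 0 0 * b + v 0 1 * a) *: u + v 0 1 *: t.
  rewrite lfunE /= mulmx_sum_row !big_ord_recl big_ord0 addr0 !rowK /=.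
  rewrite (_ : lift ord0 ord0 = 1); last exact: val_inj.
  by rewrite scalerDr !scalerA addrA addrAC addrC scalerDl addrC.
have ker_g : lker g == 0%VS.
  apply/lker0P=> v v'; rewrite !gE => /(ut_inj dim_ut)[E E1].
  apply/rowP=> i; case: (unliftP 0 i) => [j|] ->.
    by rewrite [j]ord1 (_ : lift _ _ = 1) //; exact: val_inj.
  by move: E; rewrite E1 => /addIr/(mulIf b0).
apply/existsP; exists g; apply/and3P; split=> //.
  rewrite eqEdim; apply/andP; split.
    apply/subvP=> _ /memv_imgP[v _ ->]; rewrite gE.
    by apply/memv_addv_lineP; do 2!eexists.
  rewrite limg_dim_eq ?(eqP ker_g) ?capv0 //.
  by rewrite dim_ut dimvf /dim /=.
apply/eqP/setP=> P; apply/setU1P/imsetP=> [[->|] | ].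
- pose e : 'rV[F]_2 := delta_mx 0 0; exists <[e]>%VS.
    apply/canonical_PGP; exists e; split=> //; last first.
      by apply/mxOverP=> i j; rewrite mxE rpred_nat.
    apply/eqP=> /rowP/(_ 0)/eqP; rewrite !mxE !eqxx.
    by rewrite oner_eq0.
  by rewrite limg_line gE !mxE !eqxx /= mul1r mul0r scale0r !addr0 vline_scale.
- case/imsetP=> _ /imsetP[k Kk ->] ->.
  pose v : 'rV[F]_2 := \row_i [:: k; 1]`_i.
  exists <[v]>%VS.
    apply/canonical_PGP; exists v; split=> //.
      by apply/eqP=> /rowP/(_ 1)/eqP; rewrite !mxE oner_eq0.
    apply/mxOverP=> i j; rewrite mxE; case: (unliftP 0 j) => [j'|] -> //=.
    by rewrite [j']ord1 rpred1.
  rewrite limg_line gE !mxE /= mul1r normalize_affine_point ?oner_neq0 //.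
  by rewrite divr1 mulrC addrC.
- case=> _ /canonical_PGP[v [v0 Kv ->]]; rewrite limg_line gE => ->.
  have {}Kv i : v 0 i \in K by have /mxOverP := Kv.
  have [v1 | v1] := eqVneq (v 0 1) 0; [left | right].
    rewrite v1 mul0r scale0r !addr0 vline_scale // mulf_neq0 //.
    apply: contraNneq v0 => v00; apply/eqP/rowP=> i; rewrite mxE.
    case: (unliftP 0 i) => [j|] ->; rewrite ?v00 // [j]ord1.
    by rewrite (_ : lift _ _ = 1) //; exact: val_inj.
  rewrite normalize_affine_point //; apply: imset_f.
  by apply/imsetP; exists (v 0 0 / v 0 1); [rewrite rpred_div | field].
Qed.

(** What remains after describing the sublines through the centre is to see that a + K b lies in K +
    K w exactly when a and b do. *)
Lemma splash_linesE (S : {set {vspace 'rV[F]_3}}) (w : F) :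
  <[u]>%VS \in S -> S :\ <[u]>%VS = phi @: Kplane K w ->
  splash_lines q (<[u]> + <[t]>)%VS <[u]>%VS S =
    [set phi @: (l : {set F}) | l in Kplane_lines K w].
Proof.
move=> Su defS; apply/setP=> l; have phi_inj := affine_point_inj dim_ut.
have phi_neq z : phi z != <[u]>%VS := affine_point_neq_origin dim_ut z.
apply/imsetP/imsetP=> [[s] | [_ /imset2P[a b Wa /setD1P[b0 Wb] ->] ->]].
  rewrite inE => /and3P[/subline_through_origin subl_s /subl_s[b b0 [a def_s]]].
  move=> /subsetP sS ->; exists (Kline K a b) => //.
  have inW z : z \in Kline K a b -> z \in Kplane K w.
    move=> lz; rewrite -(mem_imset (mem (Kplane K w)) _ phi_inj) -defS.
    rewrite !inE phi_neq sS //; have: phi z \in s :\ <[u]>%VS.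
      by rewrite def_s imset_f.
    by case/setD1P.
  have Wa : a \in Kplane K w by rewrite inW ?Kline_start.
  (* The direction b is the difference of the points a + b and a, both in K + K w. *)
  apply: imset2_f; rewrite // !inE b0 -(addKr a b) addrC KplaneB // inW //.
  by apply/imsetP; exists 1; rewrite ?rpred1 ?mulr1.
exists (<[u]>%VS |: phi @: Kline K a b); last first.
  by rewrite setU1K //; apply/imsetP=> -[z _ /esym/eqP]; apply/negP/phi_neq.
rewrite inE affine_line_subline // setU11 /= subUset sub1set Su.
apply: (@subset_trans _ _ (mem (S :\ <[u]>%VS))); last exact: subD1set.
by rewrite defS imsetS // Kline_sub.
Qed.

End SplashLines.

(** * Coordinates for a tangent splash *)

Lemma splashP (B : {set {vspace 'rV[F]_3}}) (linf P : {vspace 'rV[F]_3}) :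
  {in B, forall X, is_point X} ->
  reflect (P \in points_on linf /\
           exists X Y, [/\ X \in B, Y \in B, X != Y & (P <= X + Y)%VS])
          (P \in splash B linf).
Proof.
move=> Bpoint.
apply: (iffP setIdP) => [[linfP ext_lines] | [linfP [X [Y [BX BY neqXY PXY]]]]].
  split=> //; case/existsP: ext_lines => l /andP[]; rewrite inE => /andP[/eqP dim_l].
  case/card_gt1P=> X [Y []]; rewrite !inE => /and3P[BX _ lX] /and3P[BY _ lY] neqXY Pl.
  exists X, Y; split=> //.
  (* A line containing two distinct points of B is their sum, so extended lines can be replaced by
     pairs of points of B. *)
  have /is_pointP[x x0 defX] := Bpoint X BX; have /is_pointP[y y0 defY] := Bpoint Y BY.
  by rewrite defX defY (addv_line_eq (U := l)) ?memvE -?defX -?defY //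
             defX defY dim_addv_line_neq // -defX -defY.
split=> //; apply/existsP; exists (X + Y)%VS; rewrite PXY andbT inE; apply/andP; split.
  have /is_pointP[x x0 defX] := Bpoint X BX; have /is_pointP[y y0 defY] := Bpoint Y BY.
  by rewrite /is_line defX defY dim_addv_line_neq // -defX -defY.
apply/card_gt1P; exists X, Y; split=> //.
  by rewrite !inE BX Bpoint //= addvSl.
by rewrite !inE BY Bpoint //= addvSr.
Qed.

(** Everything is pulled back along the isomorphism f defining the subplane, so that points of B
    become K-rational vectors and can be compared in a K-basis v0, v1, v2 with f v0 spanning T. *)
Lemma tangent_splash_coordinates (B : {set {vspace 'rV[F]_3}})
    (linf T : {vspace 'rV[F]_3}) :
  subplane q B -> is_line linf -> B :&: points_on linf = [set T] ->
  exists u t w, [/\ w \notin K, \dim (<[u]> + <[t]>) = 2,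
    linf = (<[u]> + <[t]>)%VS /\ T = <[u]>%VS, T \in splash B linf &
    splash B linf :\ T = affine_point u t @: Kplane K w].
Proof.
case/existsP=> f /andP[ker_f /eqP defB] /eqP dim_linf tangent.
have f_inj := lker0P ker_f.
have BP P : reflect (exists v, [/\ v != 0, v \is a mxOver K & P = <[f v]>%VS]) (P \in B).
  rewrite defB; apply: (iffP imsetP) => [[_ /canonical_PGP[v [v0 Kv ->]] ->] | ].
    by exists v; rewrite limg_line.
  move=> [v [v0 Kv ->]]; exists <[v]>%VS; last by rewrite limg_line.
  by apply/canonical_PGP; exists v.
have f_neq0 v : v != 0 -> f v != 0 by move=> v0; rewrite -(linear0 f) (inj_eq f_inj).
have: T \in B :&: points_on linf by rewrite tangent set11.
case/setIP=> /BP[v0 [v0_neq0 Kv0 defT]]; rewrite inE defT -memvE => /andP[_ linf_v0].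
have [e [Ke span_e K_e free_e]] := mxOver_extend_basis v0_neq0 Kv0.
pose v1 := e ord0; pose v2 := e (lift ord0 ord0).
have sumE a (c : 'I_2 -> F) :
    a *: v0 + \sum_j c j *: e j = a *: v0 + c ord0 *: v1 + c (lift ord0 ord0) *: v2.
  by rewrite !big_ord_recl big_ord0 addr0 addrA.
have span_v v : exists a b c, v = a *: v0 + b *: v1 + c *: v2.
  have [a [c ->]] := span_e v; rewrite sumE.
  by do 3!eexists.
have K_v a b c : a *: v0 + b *: v1 + c *: v2 \is a mxOver K ->
    [/\ a \in K, b \in K & c \in K].
  move=> Kv; have := K_e a (fun j => [:: b; c]`_j); rewrite sumE => /(_ Kv)[Ka Kbc].
  by split; [|exact: Kbc ord0|exact: Kbc (lift ord0 ord0)].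
have free_v a b c : a *: v0 + b *: v1 + c *: v2 = 0 -> [/\ a = 0, b = 0 & c = 0].
  move=> E; have := free_e a (fun j => [:: b; c]`_j); rewrite sumE => /(_ E)[a0 bc0].
  by split; [|exact: bc0 ord0|exact: bc0 (lift ord0 ord0)].
have comb_K a b c : a \in K -> b \in K -> c \in K ->
    a *: v0 + b *: v1 + c *: v2 \is a mxOver K.
  by move=> Ka Kb Kc; rewrite !rpredD // mxOverZ ?Ke.
(* A nonzero such vector would yield a point of B on [linf], hence T itself, against the
   independence of v0, v1, v2. *)
have tangentE b c : b \in K -> c \in K -> f (b *: v1 + c *: v2) \in linf ->
    b = 0 /\ c = 0.
  move=> Kb Kc linf_v; pose v := b *: v1 + c *: v2.
  have [v_eq0 | v_neq0] := eqVneq v 0.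
    by have [|_ -> ->] := free_v 0 b c; rewrite ?scale0r ?add0r.
  have: <[f v]>%VS \in B :&: points_on linf.
    rewrite !inE -memvE linf_v andbT; apply/andP; split.
      apply/BP; exists v; split=> //.
      by have := comb_K 0 b c (rpred0 K) Kb Kc; rewrite scale0r add0r.
    by apply/is_pointP; exists (f v); rewrite ?f_neq0.
  rewrite tangent defT => /set1P/esym/vline_inj[|k k0]; first exact: f_neq0.
  rewrite -linearZ => /f_inj E; have [|_ -> ->] := free_v (- k) b c => //.
  by rewrite -addrA -/v E scaleNr addNr.
(* Take a point of [linf] outside T and remove its v0-part, leaving b v1 + c v2. Here c != 0, since
   otherwise v1 would give a second point of B on [linf]; then w = b / c. *)
have [w linf_w] : exists w, f (w *: v1 + v2) \in linf.
  have /subvPn[x linf_x] : ~~ (linf <= <[f v0]>)%VS.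
    by apply/negP=> /dimvS; rewrite dim_linf dim_vline f_neq0.
  have /memv_imgP[y _ def_x] : x \in limg f by rewrite lker0_limgf ?memvf.
  have [a [b [c def_y]]] := span_v y; rewrite {x}def_x def_y in linf_x *.
  rewrite -addrA linearD linearZ in linf_x *.
  rewrite rpredDl ?memvZ ?memv_line // => nv.
  have {linf_x} linf_bc : f (b *: v1 + c *: v2) \in linf.
    by rewrite rpredDl ?memvZ // in linf_x.
  have [c0 | c0] := eqVneq c 0; last first.
    exists (b / c); have := memvZ c^-1 linf_bc.
    by rewrite -linearZ scalerDr !scalerA mulVf // scale1r mulrC.
  have b0 : b != 0.
    apply: contraNneq nv => b0.
    by rewrite b0 c0 !scale0r addr0 linear0 mem0v.
  have linf_v1 : f (1 *: v1 + 0 *: v2) \in linf.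
    have := memvZ b^-1 linf_bc.
    by rewrite -linearZ scalerDr !scalerA mulVf // c0 mulr0.
  by have [/eqP] := tangentE 1 0 (rpred1 K) (rpred0 K) linf_v1; rewrite oner_eq0.
have nKw : w \notin K.
  apply/negP=> Kw; have [|_ /eqP] := tangentE w 1 Kw (rpred1 K); first by rewrite scale1r.
  by rewrite oner_eq0.
set u := f v0; set t := f (w *: v1 + v2) in linf_w.
have f_coord a b : a *: u + b *: t = f (a *: v0 + (b * w) *: v1 + b *: v2).
  by rewrite -!linearZ -linearD scalerDr scalerA addrA.
have dim_ut : \dim (<[u]> + <[t]>) = 2.
  apply/eqP/dim_addv_lineP=> a b; rewrite f_coord -(linear0 f) => /f_inj.
  by case/free_v=> -> _ ->.
have def_linf : linf = (<[u]> + <[t]>)%VS by rewrite (addv_line_eq _ _ dim_linf).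
have Bpoint : {in B, forall X, is_point X}.
  by move=> _ /BP[v [v_neq0 _ ->]]; apply/is_pointP; exists (f v); rewrite ?f_neq0.
(* Independent K-rational x and y give two distinct points of B, so a point of [linf] on their join
   belongs to the splash. *)
have in_splash x y p : x \is a mxOver K -> y \is a mxOver K ->
    (forall a b, a *: x + b *: y = 0 -> a = 0 /\ b = 0) -> p != 0 -> p \in linf ->
    p \in (<[f x]> + <[f y]>)%VS -> <[p]>%VS \in splash B linf.
  move=> Kx Ky free_xy p0 linf_p xy_p; apply/(splashP linf _ Bpoint); split.
    by rewrite inE -memvE linf_p andbT; apply/is_pointP; exists p.
  have x0 : x != 0.
    apply/eqP=> x0; have [|/eqP] := free_xy 1 0; last by rewrite oner_eq0.
    by rewrite x0 scaler0 scale0r addr0.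
  have y0 : y != 0.
    apply/eqP=> y0; have [|_ /eqP] := free_xy 0 1; last by rewrite oner_eq0.
    by rewrite y0 scaler0 scale0r addr0.
  exists <[f x]>%VS, <[f y]>%VS; split=> //.
  - by apply/BP; exists x.
  - by apply/BP; exists y.
  apply/eqP=> /vline_inj[|c _]; first exact: f_neq0.
  rewrite -linearZ => /f_inj def_y; have [|_ /eqP] := free_xy (- c) 1.
    by rewrite def_y scale1r scaleNr addNr.
  by rewrite oner_eq0.
exists u, t, w; split=> //.
  apply: (in_splash v0 v1); rewrite ?f_neq0 ?Ke //.
    by move=> a b E; have [|-> -> _] := free_v a b 0; rewrite ?scale0r ?addr0.
  exact: (subvP (addvSl _ _)) (memv_line _).
apply/setP=> P; apply/setD1P/imsetP=> [[neqPT] | [_ /imset2P[x y Kx Ky ->] ->]].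
  case/(splashP linf _ Bpoint)=> linfP [_ [_ [/BP[x [_ Kx ->]] /BP[y [_ Ky ->]] _ Pxy]]].
  move: linfP; rewrite inE => /andP[/is_pointP[p p0 defP]].
  rewrite defP -memvE def_linf => /memv_addv_lineP[s [r def_p]].
  move: Pxy; rewrite defP -memvE => /memv_addv_lineP[a [b]].
  (* With p = s u + r t, the case r = 0 would make P the centre T. *)
  have r0 : r != 0.
    apply: contraNneq neqPT => r0; rewrite defP def_p r0 scale0r addr0 vline_scale //.
    by apply: contraNneq p0 => s0; rewrite def_p s0 r0 !scale0r addr0.
  have [x0 [x1 [x2 def_x]]] := span_v x; have [y0 [y1 [y2 def_y]]] := span_v y.
  rewrite def_x in Kx *; rewrite def_y in Ky *.
  rewrite def_p f_coord -!linearZ -linearD => /f_inj E.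
  (* Comparing coordinates in v0, v1, v2 gives a x0 + b y0 = s together with the two equations that
     [Kplane_cramer] needs to place s / r in K + K w. *)
  have [|E0 E1 E2] :=
    free_v (a * x0 + b * y0 - s) (a * x1 + b * y1 - r * w) (a * x2 + b * y2 - r).
    move/eqP: E; rewrite eq_sym -subr_eq0 => /eqP <-.
    by apply/rowP=> i; rewrite !mxE; ring.
  exists (s / r); last by rewrite -f_coord normalize_affine_point.
  rewrite -(subr0_eq E0).
  by apply: (Kplane_cramer nKw r0 (K_v _ _ _ Kx) (K_v _ _ _ Ky)); apply: subr0_eq.
split; first exact: affine_point_neq_origin.
(* The point with coordinate x + y w lies on the join of the K-rational vectors v1 + y v0 and v2 + x
   v0: weights w and 1 give w v1 + v2 + (x + y w) v0. *)
apply: (in_splash (y *: v0 + 1 *: v1 + 0 *: v2) (x *: v0 + 0 *: v1 + 1 *: v2)).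
- by rewrite comb_K ?rpred0 ?rpred1.
- by rewrite comb_K ?rpred0 ?rpred1.
- move=> a b E; have [|_ -> ->] // := free_v (a * y + b * x) a b.
  by rewrite -E; apply/rowP=> i; rewrite !mxE; ring.
- exact: affine_point_neq0.
- rewrite def_linf addrC; apply/memv_addv_lineP.
  by exists (x + y * w), 1; rewrite scale1r.
apply/memv_addv_lineP; exists w, 1.
have -> : t + (x + y * w) *: u = f (w *: v1 + v2 + (x + y * w) *: v0).
  by rewrite linearD linearZ.
rewrite -linearZ -linearZ -linearD; congr (f _).
by apply/rowP=> i; rewrite !mxE; ring.
Qed.

End Geometry.

(** * The tangent splash as an affine plane of order q *)

Theorem theorem3p2 (q p h : nat) (hp : prime p) (hh : (0 < h)%N)
    (hq : q = (p ^ h)%N)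
    (F : finFieldType) (hF : #|F| = (q ^ 3)%N)
    (linf : {vspace 'rV[F]_3}) (hlinf : is_line linf)
    (B : {set {vspace 'rV[F]_3}}) (hB : subplane q B)
    (T : {vspace 'rV[F]_3}) (hT : B :&: points_on linf = [set T]) :
  #|splash B linf :\ T| = (q ^ 2)%N /\
  affine_plane_of_order q (splash B linf :\ T)
    (splash_lines q linf T (splash B linf)).
Proof.
have Fq_closed := Fq_divring_closed hp hq hF.
pose K : divringClosed F :=
  HB.pack (Fq (F := F) q) (GRing.isDivringClosed.Build F (Fq (F := F) q) Fq_closed).
have FqK : Fq (F := F) q =i K by [].
have cardK : #|K| = q := card_Fq hp hh hq hF.
have [u [t [w [nKw dim_ut [def_linf defT] ST defS]]]] :=
  tangent_splash_coordinates FqK hB hlinf hT.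
have phi_inj := affine_point_inj dim_ut.
rewrite def_linf defT in ST defS *; split.
  by rewrite defS card_imset // card_Kplane // cardK.
rewrite (splash_linesE FqK dim_ut ST defS) defS -{1}cardK.
exact: affine_plane_of_order_imset (Kplane_affine_plane nKw).
Qed.
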